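(* Let $(X,\mu)$ be a $\sigma$-finite standard measure space, $K$ a compact (second countable) abelian group with Haar measure $\nu$, and $\Gamma$ a countable discrete group. Let $\alpha: \Gamma \curvearrowright (X,\mu)$ be a measure preserving action, let $\beta: \Gamma \curvearrowright (K,\nu)$ be an action by continuous group automorphisms, and let $c: \Gamma\times X\to K$ be a $\beta$-cocycle for $\alpha$. Let $\rho = \rho(\alpha,\beta,c): \Gamma \curvearrowright (X\times K,\mu\times\nu)$ be the twisted skew product action and let $\rho_0 = \alpha\times\beta$ be the diagonal product action on $X \times K$. If $\rho_0$ is ergodic, then $\rho$ is ergodic (irrespective of the $\beta$-cocycle $c$).
   Context: A $\beta$-cocycle for $\alpha$ is a Borel map $c:\Gamma\times X\to K$ satisfying $c(h,\alpha_g(x))\,\beta_h(c(g,x)) = c(hg,x)$ for all $g,h\in\Gamma$ and a.e. $x\in X$. The associated twisted skew product action is $\rho_g(x,k) = (\alpha_g(x), c(g,x)\beta_g(k))$. An action is ergodic if every invariant Borel set is null or conull. *)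

(* Defs.v *)
From HB Require Import structures.
From mathcomp Require Import all_boot all_order all_algebra all_fingroup.
From mathcomp Require Import all_classical all_reals all_analysis.

Set Implicit Arguments.
Unset Strict Implicit.
Unset Printing Implicit Defensive.

Import Order.TTheory GRing.Theory Num.Theory.

Local Open Scope classical_set_scope.
Local Open Scope ring_scope.

(* MathComp-Analysis measurable types are pointed, but topologicalZmodType does
   not inherit from pointedType; we point the group at 0. *)
Definition pointed_group (K : topologicalZmodType) : Type := K.

HB.instance Definition _ (K : topologicalZmodType) :=
  Choice.on (pointed_group K).
HB.instance Definition _ (K : topologicalZmodType) :=
  isPointed.Build (pointed_group K) (0 : K).

Notation borel K :=
  (@g_sigma_algebraType (pointed_group K) (@open K)).

(* The sigma-algebra of T is the Borel sigma-algebra of a Polish topology,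
   carried to T along the bijection f. A Hausdorff pseudometric is a metric. *)
Definition standard_borel (R : realType) d (T : measurableType d) : Prop :=
  exists (P : completePseudoMetricType R) (f : T -> P),
    [/\ hausdorff_space P,
        exists2 D : set P, countable D & dense D,
        bijective f &
        forall A : set T, measurable A <-> <<s @open P >> (f @` A)].

(* In a second countable locally compact group, a Borel measure that is finite
   on compact sets is regular, so regularity is not required separately. *)
Definition haar_measure (R : realType) (K : topologicalZmodType)
    (nu : set (borel K) -> \bar R) : Prop :=
  [/\ nu setT <> 0%E,
      forall A : set K, compact A -> (nu A < +oo)%E &
      forall (k : K) (A : set (borel K)), measurable A ->
        nu [set k + x | x in (A : set K)] = nu A].

Definition is_action (G : groupType) (T : Type) (a : G -> T -> T) : Prop :=
  (forall x, a 1%g x = x) /\ (forall g h x, a (g * h)%g x = a g (a h x)).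

Definition measure_preserving (R : realType) d (T : measurableType d)
    (mu : set T -> \bar R) (f : T -> T) : Prop :=
  measurable_fun setT f /\
  forall A, measurable A -> mu (f @^-1` A) = mu A.

Definition measure_preserving_action (R : realType) d (T : measurableType d)
    (mu : set T -> \bar R) (G : groupType) (a : G -> T -> T) : Prop :=
  is_action a /\ forall g, measure_preserving mu (a g).

(* The inverse of b g is b g^-1, so each b g is a homeomorphism. *)
Definition continuous_automorphism_action (G : groupType)
    (K : topologicalZmodType) (b : G -> K -> K) : Prop :=
  [/\ is_action b,
      forall g k l, b g (k + l) = b g k + b g l &
      forall g, continuous (b g)].

(* G is discrete and countable, so Borel measurability of c on G * X amounts to
   measurability of each c g. *)
Definition is_cocycle (R : realType) d (X : measurableType d)
    (mu : set X -> \bar R) (K : topologicalZmodType) (G : groupType)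
    (a : G -> X -> X) (b : G -> K -> K) (c : G -> X -> K) : Prop :=
  (forall g, measurable_fun setT (c g : X -> borel K)) /\
  (forall g h, {ae mu, forall x,
     c h (a g x) + b h (c g x) = c (h * g)%g x}).

Definition skew_product (X : Type) (K : topologicalZmodType) (G : groupType)
    (a : G -> X -> X) (b : G -> K -> K) (c : G -> X -> K)
    (g : G) (p : X * borel K) : X * borel K :=
  (a g p.1, c g p.1 + b g p.2).

Definition diagonal_action (X : Type) (K : topologicalZmodType)
    (G : groupType) (a : G -> X -> X) (b : G -> K -> K)
    (g : G) (p : X * borel K) : X * borel K :=
  (a g p.1, b g p.2).

(* Stated for a family of maps: since the cocycle identity holds only almost
   everywhere, a skew product is an action only up to null sets. *)
Definition ergodic (R : realType) d (T : measurableType d)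
    (mu : set T -> \bar R) (G : Type) (a : G -> T -> T) : Prop :=
  forall E : set T, measurable E -> (forall g, a g @^-1` E = E) ->
    mu E = 0%E \/ mu (~` E) = 0%E.

(* Main.v *)
Require Import Defs.
From HB Require Import structures.
From mathcomp Require Import all_boot all_order all_algebra all_fingroup.
From mathcomp Require Import all_classical all_reals all_analysis.
From mathcomp Require Import measurable_realfun.

(** Write E_x for the section over x of a skew-product invariant set E. Exact
    invariance of E says that l belongs to E_x iff c g x + beta_g l belongs to
    E_(alpha_g x): sections over one orbit agree up to an affine
    automorphism of K, and Haar measure does not see such a map. Hence every
    quantity built from E_x by translations and nu depends on the cocycle in
    no way, and yields sets invariant under the diagonal action.

    The quantity used is the shift defect
      psi (x, k) = nu (E_x \ (E_x - k)),
    which satisfies psi (alpha_g x, beta_g k) = psi (x, k). For every e > 0 the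
    set {psi < e} is therefore null or conull, by ergodicity of the diagonal
    action. Its section over every x contains a neighbourhood of 0, because
    translation is continuous in measure at 0 (lemma moved_into_self), and
    neighbourhoods of 0 have positive Haar measure (lemma
    haar_nbhs_pos). So {psi < e} is not null unless mu = 0, hence conull. Letting
    e tend to 0, for almost all x the section E_x is contained, modulo nu, in
    almost all of its translates. By Fubini such a set satisfies
    nu (E_x) * nu (K \ E_x) = 0 (lemma shift_invariant_null_or_conull).

    Finally x |-> nu (E_x) is alpha-invariant, so {x | nu (E_x) = 0} * K is
    invariant under the diagonal action: either almost all sections are null,
    or almost all are conull, and E is null or conull accordingly.

    This argument takes the place of the Fourier expansion along K: in Fourier
    terms, k |-> nu (E_x `&` (E_x - k)) is the function whose coefficients are
    the squared moduli of those of the indicator of E_x, and the phases are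
    where the cocycle acts. *)

Set Implicit Arguments.
Unset Strict Implicit.
Unset Printing Implicit Defensive.

Import Order.TTheory GRing.Theory Num.Theory.

Local Open Scope classical_set_scope.
Local Open Scope ring_scope.

(** * Borel structure of a second countable group *)

(** Indexing by an injection of the base into nat leaves some indices empty; the
    union over each fibre of that injection gives such indices the empty set. *)
Lemma second_countable_sequence (T : topologicalType) :
  @second_countable T -> exists B : nat -> set T,
    (forall n, open (B n)) /\
    (forall x U, nbhs x U -> exists n, B n x /\ B n `<=` U).
Proof.
move=> [Bs /countable_injP[f finj] [Bopen Bnbhs]].
exists (fun n => \bigcup_(U in [set U | Bs U /\ f U = n]) U); split=> [n|x U xU].
  by apply: bigcup_open => U [BU _]; exact: Bopen.
have [V [BV Vx] VU] := Bnbhs x U xU.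
exists (f V); split=> [|y [W [BW fWV] Wy]]; first by exists V.
by apply: VU; rewrite -(finj W V) ?inE.
Qed.

Lemma open_borel (K : topologicalZmodType) (U : set K) :
  open U -> measurable (U : set (borel K)).
Proof. by move=> oU; exact: sub_sigma_algebra. Qed.

Lemma measurable_fun_borel (K : topologicalZmodType) d (T : measurableType d)
    (f : T -> borel K) :
  (forall U : set K, open U -> measurable (f @^-1` U)) -> measurable_fun setT f.
Proof.
move=> fU; apply: (measurability (@open K : set (set (borel K)))) => //.
by move=> _ [U oU <-]; rewrite setTI; exact: fU.
Qed.

Lemma continuous_borel (K : topologicalZmodType) (f : K -> K) :
  continuous f -> measurable_fun setT (f : borel K -> borel K).
Proof.
move=> /continuousP cf; apply: measurable_fun_borel => U oU.
by apply: open_borel; exact: cf.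
Qed.

(** Second countability is what makes the product of the Borel sigma-algebras
    contain the open sets of K * K: the preimage of an open set is a countable
    union of rectangles of basic open sets. *)
Lemma measurable_add_borel (K : topologicalZmodType) :
  @second_countable K ->
  measurable_fun setT
    (fun p : borel K * borel K => (p.1 : K) + (p.2 : K) : borel K).
Proof.
move=> /second_countable_sequence[B [Bo Bb]].
apply: measurable_fun_borel => U oU.
rewrite [X in measurable X](_ : _ = \bigcup_n \bigcup_m
   [set p | [/\ B n p.1, B m p.2 &
      forall x y, B n x -> B m y -> U ((x : K) + (y : K))]]); last first.
  apply/seteqP; split=> [[x y] /= Uxy|[x y] [n _] [m _] /= [Bx By H]]; last exact: H.
  have : nbhs (x, y) ((fun p : K * K => p.1 + p.2) @^-1` U).
    by apply: add_continuous; apply: open_nbhs_nbhs; split.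
  move=> [[P Q] /= [Px Qy] PQ].
  have [n [Bnx BnP]] := Bb _ _ Px.
  have [m [Bmy BmQ]] := Bb _ _ Qy.
  exists n => //; exists m => //=; split=> // x' y' Bx' By'.
  by apply: (PQ (x', y')); split; [exact: BnP|exact: BmQ].
apply: bigcupT_measurable => n; apply: bigcupT_measurable => m.
have [H|nH] := pselect (forall x y, B n x -> B m y -> U ((x : K) + (y : K))).
  rewrite [X in measurable X](_ : _ = (B n : set (borel K)) `*` (B m : set (borel K))).
    by apply: measurableX; exact: open_borel.
  by apply/seteqP; split=> [[x y] []|[x y] []].
rewrite [X in measurable X](_ : _ = set0); first exact: measurable0.
by apply/seteqP; split=> [[x y] []|].
Qed.

Lemma measurable_funD_borel (K : topologicalZmodType) d (T : measurableType d)
    (f g : T -> borel K) :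
  @second_countable K -> measurable_fun setT f -> measurable_fun setT g ->
  measurable_fun setT (fun x => (f x : K) + (g x : K) : borel K).
Proof.
move=> /measurable_add_borel mD mf mg.
exact: (measurableT_comp mD (measurable_fun_pair mf mg)).
Qed.

(** * Haar measure *)

(** The translate A - k, written as a preimage: most arguments below apply
    measurability and measure preservation of maps. *)
Definition shift (K : topologicalZmodType) (k : K) (A : set (borel K)) :
  set (borel K) := [set l | A (k + (l : K))].

Lemma haar_shift (R : realType) (K : topologicalZmodType)
    (nu : set (borel K) -> \bar R) (k : K) (A : set (borel K)) :
  haar_measure nu -> measurable A ->
  nu (shift k A) = nu A.
Proof.
move=> [_ _ nuD] mA; rewrite -(nuD (- k) A mA); congr (nu _).
apply/seteqP; split=> [l /= Al|_ [l Al <-]] /=.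
  by exists (k + (l : K)) => //; rewrite addKr.
by rewrite /shift/= addNKr.
Qed.

Lemma measure_sections_fubini (R : realType) d1 d2 (T1 : measurableType d1)
    (T2 : measurableType d2) (m1 : {sigma_finite_measure set T1 -> \bar R})
    (m2 : {sigma_finite_measure set T2 -> \bar R}) (A : set (T1 * T2)) :
  measurable A ->
  (\int[m1]_x m2 (xsection A x) = \int[m2]_y m1 (ysection A y))%E.
Proof.
move=> mA; have := indic_fubini_tonelli m1 m2 mA.
by rewrite indic_fubini_tonelli_FE// indic_fubini_tonelli_GE.
Qed.

Lemma haar_finite (R : realType) (K : topologicalZmodType)
    (nu : set (borel K) -> \bar R) :
  compact [set: K] -> haar_measure nu -> (nu setT < +oo)%E.
Proof. by move=> cK [_ H _]; exact: H. Qed.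

(** Uniqueness of Haar measure in the one case needed. Both iterated integrals of
    the set of (x, y) with f x + y in A can be computed by translation
    invariance: the sections over x are translates of A, those over y are
    translates of the preimage of A by f (write y as f z). *)
Lemma haar_automorphism_invariant (R : realType) (K : topologicalZmodType)
    (nu : {sigma_finite_measure set (borel K) -> \bar R}) (f : K -> K)
    (A : set (borel K)) :
  @second_countable K -> haar_measure nu -> (nu setT < +oo)%E ->
  continuous f -> (forall k l, f (k + l) = f k + f l) ->
  (forall k, exists l, f l = k) ->
  measurable A -> nu [set l | A (f l)] = nu A.
Proof.
move=> K2 hnu nuoo cf fD fsurj mA.
have mf := continuous_borel cf.
pose S : set (borel K * borel K) := [set p | A (f p.1 + (p.2 : K))].
have mS : measurable S.
  rewrite -[S]setTI.
  have /measurable_funD_borel : measurable_fun setT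
      (fun p : borel K * borel K => f p.1 : borel K).
    exact: (measurableT_comp mf measurable_fst).
  by move=> /(_ _ K2 measurable_snd); exact.
have mfA : measurable [set l : borel K | A (f l)].
  by rewrite -[X in measurable X]setTI; exact: mf.
have := measure_sections_fubini nu nu mS.
under eq_integral => x _.
  rewrite (_ : xsection S x = shift (f x) A); last first.
    by rewrite xsectionE.
  rewrite haar_shift//.
  over.
rewrite integral_cst//.
under eq_integral => y _.
  have [z fz] := fsurj y.
  rewrite (_ : ysection S y = shift z [set l | A (f l)]); last first.
    by rewrite ysectionE; apply/seteqP; split=> l; rewrite /shift/= fD fz addrC.
  rewrite (haar_shift z hnu mfA).
  over.
rewrite integral_cst// => nuAE.
have nuT0 : (0 < nu setT)%E by rewrite lt0e measure_ge0 andbT; case: hnu => /eqP.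
have nuTfin : nu setT \is a fin_num by rewrite ge0_fin_numE.
apply/le_anti.
rewrite -(lee_pmul2r nuTfin nuT0) -[X in _ && X](lee_pmul2r nuTfin nuT0).
by rewrite nuAE !lexx.
Qed.

Lemma measurable_shift (K : topologicalZmodType) (k : K)
    (B : set (borel K)) :
  @second_countable K -> measurable B ->
  measurable (shift k B).
Proof.
move=> K2 mB; rewrite -[X in measurable X]setTI.
have mk : measurable_fun setT ((fun=> k) : borel K -> borel K).
  exact: measurable_cst.
have h := measurable_funD_borel K2 mk (@measurable_id _ (borel K) setT).
exact: (h measurableT B mB).
Qed.

(** * Continuity of translation in measure *)

(** Small k carry A into B except for a part of A of small measure. Two sets are
    needed, although only A = B is used in the end: an open set B is exhausted
    by sets A that are moved into B but perhaps not into themselves. *)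
Definition moved_into (R : realType) (K : topologicalZmodType)
    (nu : set (borel K) -> \bar R) (A B : set (borel K)) : Prop :=
  forall e : R, 0 < e ->
    \forall k \near (0 : K), (nu (A `\` shift k B) < e%:E)%E.

Section moved_into.
Context (R : realType) (K : topologicalZmodType)
  (nu : {measure set (borel K) -> \bar R})
  (K2 : @second_countable K) (nu_haar : haar_measure nu)
  (nuoo : (nu setT < +oo)%E).
Implicit Types A B : set (borel K).

Let mD A B k : measurable A -> measurable B ->
  measurable (A `\` shift k B).
Proof. by move=> mA mB; apply: measurableD => //; exact: measurable_shift. Qed.

Lemma moved_into_set0 B : moved_into nu set0 B.
Proof.
by move=> e e0; apply: nearW => k; rewrite set0D measure0 lte_fin.
Qed.

Lemma moved_into_setU A A' B : measurable A -> measurable A' -> measurable B ->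
  moved_into nu A B -> moved_into nu A' B -> moved_into nu (A `|` A') B.
Proof.
move=> mA mA' mB AB A'B e e0.
have e20 : 0 < e / 2 by rewrite divr_gt0.
near=> k.
rewrite setDUl.
apply: (@le_lt_trans _ _ (nu (A `\` shift k B) +
                          nu (A' `\` shift k B))%E).
  by apply: measureU2; exact: mD.
rewrite [e]splitr EFinD; apply: lteD; near: k; [exact: AB|exact: A'B].
Unshelve. all: by end_near. Qed.

Lemma moved_into_sub A B B' : measurable A -> measurable B -> measurable B' ->
  B `<=` B' -> moved_into nu A B -> moved_into nu A B'.
Proof.
move=> mA mB mB' BB' AB e e0; near=> k.
apply: (@le_lt_trans _ _ (nu (A `\` shift k B))).
  apply: le_measure; rewrite ?inE; [exact: mD|exact: mD|].
  by move=> l [Al nBl]; split=> // /BB'.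
by near: k; exact: AB.
Unshelve. all: by end_near. Qed.

(** Up to measure e / 2 the union is a finite one, as nu is finite. *)
Lemma moved_into_bigcup (A : nat -> set (borel K)) B :
  (forall n, measurable (A n)) -> measurable B ->
  (forall n, moved_into nu (A n) B) -> moved_into nu (\bigcup_n A n) B.
Proof.
move=> mA mB AB e e0.
pose F n := \big[setU/set0]_(i < n) A i.
have mF n : measurable (F n) by apply: bigsetU_measurable.
have mUA : measurable (\bigcup_n A n) by exact: bigcupT_measurable.
have FB n : moved_into nu (F n) B.
  elim: n => [|n IH]; first by rewrite /F big_ord0; exact: moved_into_set0.
  rewrite /F big_ord_recr/=.
  exact: (moved_into_setU (mF n) (mA n) mB IH (AB n)).
have e20 : 0 < e / 2 by rewrite divr_gt0.
pose G n := (\bigcup_n A n) `\` F n.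
have mG n : measurable (G n) by exact: measurableD.
have G0 : \bigcap_n G n = set0.
  apply/seteqP; split=> // x Gx; have [[n _ Anx] _] := Gx 0%N I.
  have [_] := Gx n.+1 I; apply; rewrite /F big_ord_recr/=; by right.
have [N GN] : exists N, (nu (G N) < (e / 2)%:E)%E.
  have nuG0 : (nu (G 0%N) < +oo)%E.
    by apply: le_lt_trans nuoo; apply: le_measure; rewrite ?inE.
  have ndG : nonincreasing_seq G.
    by move=> m n mn; apply/subsetPset; apply: setDS; exact: subset_bigsetU.
  have mG0 : measurable (\bigcap_n G n) by exact: bigcapT_measurable.
  have := nonincreasing_cvg_mu nuG0 mG mG0 ndG.
  rewrite G0 measure0 => /(_ [set x | (x < (e / 2)%:E)%E]) [|N _ /(_ N)/= H].
    by apply: open_ereal_lt'; rewrite lte_fin.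
  by exists N; exact: H.
near=> k.
apply: (@le_lt_trans _ _ (nu (G N) + nu (F N `\` shift k B))%E).
  have mFk : measurable (F N `\` shift k B) by exact: mD.
  apply: le_trans (measureU2 nu (mG N) mFk).
  apply: le_measure; rewrite ?inE; [exact: mD|exact: measurableU|].
  by move=> l [Al nBl]; have [Fl|nFl] := pselect (F N l); [right|left].
rewrite [e]splitr EFinD; apply: lteD => //; near: k; exact: FB.
Unshelve. all: by end_near. Qed.

(** U is the union of the basic open sets C such that V + C is contained in U for
    some neighbourhood V of 0; for k in V no point of C leaves U. *)
Lemma moved_into_open (U : set K) : open U -> moved_into nu U U.
Proof.
move=> oU; have [B [Bo Bb]] := second_countable_sequence K2.
pose stays n := exists2 V : set K, nbhs 0 V &
  forall v x, V v -> B n x -> U (v + x).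
pose C n : set (borel K) := [set x | stays n /\ B n x].
have UC : (U : set (borel K)) = \bigcup_n C n.
  apply/seteqP; split=> [x Ux|x [n _ [[V V0 VB] Bx]]]; last first.
    by rewrite -[x](@add0r K); apply: VB => //; exact: nbhs_singleton.
  have : nbhs ((0 : K), (x : K)) ((fun p : K * K => p.1 + p.2) @^-1` U).
    by apply: add_continuous; rewrite /= add0r; exact: open_nbhs_nbhs.
  move=> [[V W] /= [V0 Wx] VW].
  have [n [Bnx BnW]] := Bb _ _ Wx.
  exists n => //; split=> //; exists V => // v y Vv By.
  by apply: (VW (v, y)); split=> //; exact: BnW.
have mC n : measurable (C n).
  have [Hn|Hn] := pselect (stays n).
    rewrite (_ : C n = B n); first exact: open_borel.
    by apply/seteqP; split=> [x []|x].
  rewrite (_ : C n = set0); first exact: measurable0.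
  by apply/seteqP; split=> [x []|x].
rewrite {1}UC; apply: moved_into_bigcup => //; first exact: open_borel.
move=> n e e0.
have [[V V0 VB]|Hn] := pselect (stays n).
  near=> k.
  rewrite (_ : _ `\` _ = set0) ?measure0 ?lte_fin//.
  apply/seteqP; split=> // x [[_ Bx]]; apply; apply: VB => //.
  by near: k.
suff -> : C n = set0 by exact: moved_into_set0.
by apply/seteqP; split=> [x []|x].
Unshelve. all: by end_near. Qed.

(** The sets with this property form a sigma-algebra containing the open
    sets. *)
Lemma moved_into_self A : measurable A -> moved_into nu A A.
Proof.
move=> mA; suff [] : measurable A /\ moved_into nu A A by [].
pose good (B : set (borel K)) := measurable B /\ moved_into nu B B.
have goodC (B : set (borel K)) : good B -> good (~` B).
  move=> [mB BB].
  have mCB : measurable (~` B) by exact: measurableC.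
  split=> // e e0.
  have NBB : \forall k \near (0 : K), (nu (B `\` shift (- k)%R B) < e%:E)%E.
    have /(_ (0 : K)) := @opp_continuous K.
    by rewrite /continuous_at oppr0 => /(_ _ (BB e e0)).
  near=> k.
  have mBk : measurable (B `\` shift (- k) B) by exact: mD.
  (* The points that k moves into B are, shifted by k, those of B that - k moves
     out of B. *)
  suff -> : ~` B `\` shift k (~` B) = shift k (B `\` shift (- k) B).
    by rewrite haar_shift//; near: k.
  apply/seteqP; split=> l; rewrite /shift/= addKr.
    by move=> [nBl /contrapT Bkl].
  by move=> [Bkl nBl]; split=> // /(_ Bkl).
have goodU (F : nat -> set (borel K)) :
    (forall n, good (F n)) -> good (\bigcup_n F n).
  move=> FF; have mF n : measurable (F n) by have [] := FF n.
  have mUF : measurable (\bigcup_n F n) by exact: bigcupT_measurable.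
  split=> //; apply: moved_into_bigcup => // n.
  by apply: (moved_into_sub (mF n) (mF n) mUF _ (FF n).2); exact: bigcup_sup.
suff : <<s @open K >> `<=` (good : set (set K)) by move=> /(_ A mA).
apply: smallest_sub => [|U oU]; last first.
  by split; [exact: open_borel|exact: moved_into_open].
split=> //; first by split; [exact: measurable0|exact: moved_into_set0].
by move=> B /goodC; rewrite setTD.
Unshelve. all: by end_near. Qed.

(** If U were null, so would be its translates; each point has a basic open
    neighbourhood inside a translate of U, so K would be a countable union of
    null basic open sets. *)
Lemma haar_nbhs_pos (U : set (borel K)) :
  nbhs (0 : K) U -> measurable U -> (0 < nu U)%E.
Proof.
move=> U0 mU; rewrite lt0e measure_ge0 andbT; apply/eqP => nuU0.
have [B [Bo Bb]] := second_countable_sequence K2.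
pose C n : set (borel K) := [set x | nu (B n) = 0%E /\ B n x].
have CT : setT `<=` \bigcup_n C n.
  move=> x _.
  have : nbhs (x : K) (shift (- (x : K)) U).
    have : nbhs ((- (x : K)), (x : K)) ((fun p : K * K => p.1 + p.2) @^-1` U).
      by apply: add_continuous; rewrite /= addNr.
    move=> [[V W] /= [Vx Wx] VW]; apply: filterS Wx => l Wl.
    by apply: (VW (- (x : K), l)); split=> //; exact: nbhs_singleton.
  move=> /Bb[n [Bnx BnU]]; exists n => //; split=> //.
  apply: (@subset_measure0 _ _ _ nu (B n) (shift (- (x : K)) U)) => //.
  - exact: open_borel.
  - exact: measurable_shift.
  - by rewrite haar_shift.
have : nu.-negligible (\bigcup_n C n).
  apply: negligible_bigcup => n.
  have [nuB|nuB] := pselect (nu (B n) = 0%E).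
    exists (B n : set (borel K)); split=> //; first exact: open_borel.
    by move=> x [].
  rewrite (_ : C n = set0); first exact: negligible_set0.
  by apply/seteqP; split=> [x []|].
move=> /(negligibleS CT) /(measure_negligible measurableT).
by case: nu_haar.
Qed.

End moved_into.

(** * Null sets and sections *)

Lemma product_null_sections (R : realType) d1 d2 (T1 : measurableType d1)
    (T2 : measurableType d2) (m1 : {measure set T1 -> \bar R})
    (m2 : {sigma_finite_measure set T2 -> \bar R}) (A : set (T1 * T2)) :
  measurable A ->
  (m1 \x m2)%E A = 0%E <-> {ae m1, forall x, m2 (xsection A x) = 0%E}.
Proof.
move=> mA; have mf := measurable_fun_xsection m2 mA.
have := ae_eq_integral_abs m1 measurableT mf.
rewrite (_ : (\int[m1]_(x in setT) _)%E = (m1 \x m2)%E A).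
  move=> ->; split; apply: filterS => x /=; first by move=> /(_ I).
  by move=> + _.
by apply: eq_integral => x _; rewrite gee0_abs.
Qed.

(** The set of (k, l) with l in A and l + k outside A is null by hypothesis. Its
    section over l in A is a translate of the complement of A, so its measure
    is also nu A * nu (~` A). *)
Lemma shift_invariant_null_or_conull (R : realType) (K : topologicalZmodType)
    (nu : {sigma_finite_measure set (borel K) -> \bar R}) (A : set (borel K)) :
  @second_countable K -> haar_measure nu -> measurable A ->
  {ae nu, forall k, nu (A `\` shift k A) = 0%E} ->
  nu A = 0%E \/ nu (~` A) = 0%E.
Proof.
move=> K2 nu_haar mA nuA.
pose S : set (borel K * borel K) :=
  [set p | A p.2 /\ (~` A) ((p.2 : K) + (p.1 : K))].
have mCA : measurable (~` A) by exact: measurableC.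
have mS : measurable S.
  apply: measurableI.
    by rewrite -[X in measurable X]setTI; exact: measurable_snd.
  rewrite -[X in measurable X]setTI.
  by apply: (measurable_funD_borel K2 measurable_snd measurable_fst).
have : (\int[nu]_k nu (xsection S k) = 0)%E.
  apply/(product_null_sections nu nu mS).
  apply: (@filterS _ _ (ae_filter_ringOfSetsType nu)) nuA => k nuk.
  rewrite -[RHS]nuk xsectionE; congr (nu _).
  by apply/seteqP; split=> l; rewrite /shift/= addrC.
rewrite measure_sections_fubini//.
under eq_integral => l _.
  rewrite (_ : nu _ = (nu (~` A) * (\1_A l)%:E)%E).
    over.
  rewrite ysectionE indicE; have [/set_mem Al|/negP Al] := boolP (l \in A).
    rewrite mule1 -(haar_shift l nu_haar mCA); congr (nu _).
    by apply/seteqP; split=> [k []|k].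
  rewrite mule0 (_ : _ @^-1` _ = set0) ?measure0//.
  by apply/seteqP; split=> [k [/mem_set]|].
rewrite ge0_integralZl//; last by apply/measurable_EFinP; exact: measurable_indic.
rewrite integral_indic// setIT => /eqP.
by rewrite mule_eq0 => /orP[] /eqP; [right|left].
Qed.

(** * Sections of invariant sets *)

(** The defect is the measure of the sections of a measurable subset of
    (X * K) * K. *)
Lemma measurable_shift_defect (R : realType) d (X : measurableType d)
    (K : topologicalZmodType)
    (nu : {sigma_finite_measure set (borel K) -> \bar R})
    (E : set (X * borel K)) :
  @second_countable K -> measurable E ->
  measurable_fun setT (fun p : X * borel K =>
    nu (xsection E p.1 `\` shift p.2 (xsection E p.1))).
Proof.
move=> K2 mE.
pose F : set ((X * borel K) * borel K) :=
  [set q | E (q.1.1, q.2) /\ (~` E) (q.1.1, ((q.1.2 : K) + (q.2 : K) : borel K))].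
have mx : measurable_fun setT (fun q : (X * borel K) * borel K => q.1.1).
  exact: (measurableT_comp measurable_fst measurable_fst).
have mk : measurable_fun setT (fun q : (X * borel K) * borel K => q.1.2).
  exact: (measurableT_comp measurable_snd measurable_fst).
have mF : measurable F.
  apply: measurableI.
    rewrite -[X in measurable X]setTI.
    exact: (measurable_fun_pair mx measurable_snd measurableT mE).
  rewrite -[X in measurable X]setTI.
  have mk' := measurable_funD_borel K2 mk measurable_snd.
  exact: (measurable_fun_pair mx mk' measurableT (measurableC mE)).
rewrite (_ : (fun p => _) = nu \o xsection F); first exact: measurable_fun_xsection.
apply/funext => -[x k] /=; congr (nu _).
by apply/seteqP; split=> l; rewrite /shift/= !xsectionE.
Qed.

(** The only way in which the cocycle enters the argument: through an affine map
    of K relating two sections. *)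
Lemma skew_invariant_sections d (X : measurableType d) (K : topologicalZmodType)
    (G : groupType) (alpha : G -> X -> X)
    (beta : G -> K -> K) (c : G -> X -> K) (E : set (X * borel K)) g x :
  skew_product alpha beta c g @^-1` E = E ->
  xsection E x = [set l | shift (c g x) (xsection E (alpha g x)) (beta g l)].
Proof.
by move=> gE; apply/funext => l; rewrite /shift/= !xsectionE -[in LHS]gE.
Qed.

Theorem proposition5p1 (R : realType)
    (d : measure_display) (X : measurableType d)
    (mu : {sigma_finite_measure set X -> \bar R})
    (K : topologicalZmodType)
    (nu : {sigma_finite_measure set (borel K) -> \bar R})
    (Gamma : groupType)
    (alpha : Gamma -> X -> X) (beta : Gamma -> K -> K) (c : Gamma -> X -> K)
    (X_standard : standard_borel R X)
    (K_compact : compact [set: K]) (K_hausdorff : hausdorff_space K)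
    (K_second_countable : @second_countable K)
    (nu_haar : haar_measure nu)
    (Gamma_countable : countable [set: Gamma])
    (alpha_mp : measure_preserving_action mu alpha)
    (beta_aut : continuous_automorphism_action beta)
    (c_cocycle : is_cocycle mu alpha beta c) :
  ergodic (mu \x nu)%E (diagonal_action alpha beta) ->
  ergodic (mu \x nu)%E (skew_product alpha beta c).
Proof.
move=> erg E mE EE.
have K2 := K_second_countable.
have nuoo := haar_finite K_compact nu_haar.
have [[beta1 betaM] betaD betac] := beta_aut.
have nu_beta g (A : set (borel K)) : measurable A -> nu [set l | A (beta g l)] = nu A.
  apply: haar_automorphism_invariant => // k; exists (beta g^-1%g k).
  by rewrite -betaM mulgV beta1.
have mEx x : measurable (xsection E x) by exact: measurable_xsection.
have nu_affine g x (A : set (borel K)) : measurable A ->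
    nu [set l | shift (c g x) A (beta g l)] = nu A.
  by move=> mA; rewrite nu_beta ?haar_shift//; exact: measurable_shift.
have Ex g x := skew_invariant_sections x (EE g).
pose psi (p : X * borel K) := nu (xsection E p.1 `\` shift p.2 (xsection E p.1)).
have mpsi : measurable_fun setT psi by exact: measurable_shift_defect.
have psi_inv g p : psi (diagonal_action alpha beta g p) = psi p.
  case: p => x k; rewrite /psi/=.
  rewrite -(nu_affine g x); last first.
    by apply: measurableD => //; exact: measurable_shift.
  congr (nu _); rewrite [in RHS](Ex g x).
  by apply/seteqP; split=> l; rewrite /shift/= betaD addrCA.
have mpsi0 : measurable [set p | psi p <> 0%E].
  rewrite (_ : [set p | _] = ~` (setT `&` psi @^-1` [set 0%E])); last by rewrite setTI.
  apply: measurableC; exact: mpsi.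
(* The second case only occurs for mu = 0, when all of X * K is null. *)
have psi0 : (mu \x nu)%E [set p | psi p <> 0%E] = 0%E \/ mu setT = 0%E.
  pose W n := [set p | psi p < (n.+1%:R^-1)%:E]%E.
  have mW n : measurable (W n).
    rewrite -[W n]setTI.
    exact: (emeasurable_fun_infty_o measurableT mpsi).
  have Winv n g : diagonal_action alpha beta g @^-1` W n = W n.
    by apply/seteqP; split=> p; rewrite /W /= psi_inv.
  have W_section_pos n x : (0 < nu (xsection (W n) x))%E.
    apply: haar_nbhs_pos => //; last exact: measurable_xsection.
    have n0 : 0 < n.+1%:R^-1 :> R by rewrite invr_gt0.
    apply: filterS (moved_into_self K2 nu_haar nuoo (mEx x) n0) => k nuk.
    exact/xsectionP.
  have [[n Wn]|W0] := pselect (exists n, (mu \x nu)%E (W n) = 0%E).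
    right; apply/(negligibleP mu measurableT).
    have /(product_null_sections mu nu (mW n)) := Wn.
    apply: negligibleS => x _ /= nuW.
    by have := W_section_pos n x; rewrite nuW ltxx.
  left; apply: (measure_negligible mpsi0).
  have WC : (mu \x nu)%E.-negligible (\bigcup_n ~` W n).
    apply: negligible_bigcup => n; apply/negligibleP; first exact: measurableC.
    have [Wn|//] := erg _ (mW n) (Winv n).
    by exfalso; apply: W0; exists n.
  apply: negligibleS WC => p /= psip0; apply: contrapT => nW; apply: psip0.
  have psiW n : (psi p < (n.+1%:R^-1)%:E)%E.
    by apply: contrapT => nWn; apply: nW; exists n.
  apply/eqP; rewrite eq_le measure_ge0 andbT; apply/lee_addgt0Pr => e e0.
  rewrite add0e (le_trans (ltW (psiW (Num.truncn e^-1))))// lee_fin.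
  by rewrite invf_ple ?posrE ?ltr0n// ltW// truncnS_gt.
have E01 : {ae mu, forall x, nu (xsection E x) = 0%E \/ nu (~` xsection E x) = 0%E}.
  case: psi0 => [psi0|muT0]; last first.
    have : mu.-negligible setT by exists setT.
    exact: negligibleS.
  have /(product_null_sections mu nu mpsi0) := psi0.
  apply: (@filterS _ _ (ae_filter_ringOfSetsType mu)) => x nux.
  apply: shift_invariant_null_or_conull => //.
  exists (xsection [set p | psi p <> 0%E] x); split=> //; first exact: measurable_xsection.
  by move=> k nuk; apply/xsectionP.
(* Ergodicity, applied to B * K, makes the alternative in E01 the same for almost
   all x. *)
pose B := [set x | nu (xsection E x) = 0%E].
have mB : measurable B.
  rewrite -[B]setTI.
  exact: (measurable_fun_xsection nu mE measurableT (emeasurable_set1 0%E)).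
have Binv g : diagonal_action alpha beta g @^-1` (B `*` setT) = B `*` setT.
  apply/funext => -[x k]; apply/propext; rewrite /B /setX /= !(Ex g x) nu_affine//.
have mCE : measurable (~` E) by exact: measurableC.
have nuT0 : nu setT <> 0%E by case: nu_haar.
have mBT : measurable (B `*` [set: borel K]) by exact: measurableX.
have [/(product_null_sections mu nu mBT) BT|] := erg _ mBT Binv.
  right; apply/(product_null_sections mu nu mCE).
  apply: (@filterS2 _ _ (ae_filter_ringOfSetsType mu)) E01 BT => x [nuE0|+ _].
    by rewrite in_xsectionX ?inE// => /nuT0.
  by rewrite !xsectionE.
move=> /(product_null_sections mu nu (measurableC mBT)) BT.
left; apply/(product_null_sections mu nu mE).
apply: (@filterS _ _ (ae_filter_ringOfSetsType mu)) BT => x BTx.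
apply: contrapT => nuE; apply: nuT0; rewrite -[RHS]BTx; congr (nu _).
by apply/seteqP; split=> // k _; rewrite xsectionE => -[].
Qed.
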